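(* Let $(W,S)$ be a Coxeter system and assume that there is an infinite subset $S_0\subseteq S$ such that $st=ts$ for all $s,t\in S_0$. Let $\varphi\colon W\to\mathbb{C}$ be a radial function with $\varphi(e)=1$. Then $\varphi$ is positive definite if and only if there exists a (Borel) probability measure $\mu$ on $[-1,1]$ such that $$\varphi(\sigma)=\int_{-1}^1 q^{|\sigma|}\,\mu(dq)\qquad\text{for all }\sigma\in W.$$ This measure $\mu$ is unique.
   Context: A Coxeter system $(W,S)$ is a group $W$ with a (possibly infinite) generating set $S$ and presentation $W=\langle S\mid (s_1s_2)^{m(s_1,s_2)}=1 \text{ whenever } m(s_1,s_2)\neq\infty\rangle$, where $m\colon S\times S\to\{1,2,\dots,\infty\}$ is symmetric and $m(s_1,s_2)=1$ iff $s_1=s_2$. For $w\in W$, $|w|$ is the word length of $w$ with respect to $S$. A function on $W$ is radial if its value at $w$ depends only on $|w|$. A function $\varphi\colon W\to\mathbb{C}$ is positive definite if $\sum_{x,y\in W}\varphi(y^{-1}x)\alpha(x)\overline{\alpha(y)}\ge 0$ for every finitely supported $\alpha\colon W\to\mathbb{C}$. Convention: $0^0=1$. *)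

(* Defs.v *)
From HB Require Import structures.
From mathcomp Require Import all_boot all_order all_algebra.
From mathcomp Require Import all_classical all_reals all_analysis.
From mathcomp.real_closed Require Import complex.

Set Implicit Arguments.
Unset Strict Implicit.
Unset Printing Implicit Defensive.

Import Order.TTheory GRing.Theory Num.Theory.
Import numFieldNormedType.Exports.

Local Open Scope classical_set_scope.
Local Open Scope ring_scope.

Section Coxeter.
Variable W : groupType.
Implicit Types (S : set W) (w : W) (m : W -> W -> option nat).

Definition word_of_length S w (n : nat) : Prop :=
  exists l : seq W, [/\ size l = n,
    (forall x, x \in l -> S x \/ S (x^-1)%g) & (\prod_(x <- l) x)%g = w].

Definition generates S : Prop := forall w, exists n, word_of_length S w n.

(* Only the restriction of m to S * S is meaningful; None stands for oo. *)
Definition coxeter_matrix S m : Prop :=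
  forall s t, S s -> S t ->
    [/\ m s t = m t s, m s t <> Some 0%N & m s t = Some 1%N <-> s = t].

(* f : W -> G is only evaluated on S. *)
Definition satisfies_coxeter_relations S m (G : groupType) (f : W -> G) :
    Prop :=
  forall s t k, S s -> S t -> m s t = Some k -> ((f s * f t) ^+ k = 1)%g.

(* W = < S | (s t)^m(s,t) = 1 >, by the universal property of a presentation;
   the induced homomorphism h is unique as soon as S generates W. *)
Definition coxeter_presentation S m : Prop :=
  satisfies_coxeter_relations S m id /\
  forall (G : groupType) (f : W -> G), satisfies_coxeter_relations S m f ->
    exists h : {multiplicative W -> G}, forall s, S s -> h s = f s.

Definition coxeter_system S : Prop :=
  generates S /\
  exists m, coxeter_matrix S m /\ coxeter_presentation S m.

(* The default value 0 is only used if S does not generate w. *)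
Definition word_length S w : nat :=
  xget 0%N [set n | word_of_length S w n /\
                    forall k, word_of_length S w k -> (n <= k)%N].

Definition radial S (T : Type) (phi : W -> T) : Prop :=
  forall v w, word_length S v = word_length S w -> phi v = phi w.

(* In R[i], 0 <= z means that z is real and nonnegative. *)
Definition positive_definite (R : realType) (phi : W -> R[i]) : Prop :=
  forall alpha : W -> R[i], finite_set [set x | alpha x != 0] ->
    0 <= \sum_(x \in [set: W]) \sum_(y \in [set: W])
           phi (y^-1 * x)%g * alpha x * (alpha y)^*%C.

(* Borel probability measures on [-1, 1] are represented by the Borel
   probability measures on R giving full mass to [-1, 1]. *)
Definition represents (R : realType) S (phi : W -> R[i])
    (mu : probability (measurableTypeR R) R) : Prop :=
  mu `[-1, 1]%classic = 1%E /\
  forall w, phi w =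
    (\int[mu]_(q in `[-1, 1]%classic) (q ^+ word_length S w))%:C%C.

End Coxeter.

(* Main.v *)
Require Import Defs.
From HB Require Import structures.
From mathcomp Require Import all_boot all_order all_algebra.
From mathcomp Require Import all_classical all_reals all_analysis.
From mathcomp Require Import measurable_realfun.
From mathcomp.real_closed Require Import complex.
From mathcomp Require Import ring lra.

Set Implicit Arguments.
Unset Strict Implicit.
Unset Printing Implicit Defensive.

Import Order.TTheory GRing.Theory Num.Theory.
Import numFieldNormedType.Exports.

Local Open Scope classical_set_scope.
Local Open Scope ring_scope.

(** Write N(w) for the set of reflections t with |tw| < |w|.  Then |w| is the
    cardinality of N(w), and N is a cocycle: N(xy) is the symmetric difference
    of N(x) and x N(y) x^-1.  Hence |y^-1 x| counts the reflections on which
    N(x) and N(y) disagree.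

    If phi is an integral of the functions q^|w|, it therefore suffices that
    q^|y^-1 x| is a positive definite kernel for each q in [-1, 1].  This kernel
    is a product, over the finitely many reflections involved, of kernels equal
    to 1 on agreement and q on disagreement, and each factor is a convex
    combination of two rank one kernels, with weights (1 + q) / 2 and
    (1 - q) / 2 ([agreement_kernel_ge0], [represents_positive_definite]).

    Conversely let a n be the value of phi on words of length n, and let L be
    the linear functional on polynomials with L(X^n) = a n.  Distinct commuting
    generators s_0, ..., s_(n-1) span a group of exponent 2 in which a product
    of m distinct ones has length m.  Testing positive definiteness of phi on
    the function prod_(i in A) e_i of the subset A, for signs e_i, yields
    L(prod_i (1 + e_i X)) >= 0 ([positive_definite_subset_sum]), that is
    L((1 - X)^k (1 + X)^l) >= 0 for all k and l.  After the substitution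
    X -> (1 + X) / 2 the functional L becomes a functional M which satisfies
    the positivity hypothesis M(X^k (1 - X)^l) >= 0 of the Hausdorff moment
    problem on [0, 1] ([hausdorff_moment]), whose solution yields mu.

    The solution of the moment problem is built as the law of a monotone
    function of a uniform variable.  The numbers M(C(N,k) X^k (1-X)^(N-k)) are
    the weights of a probability on the points k/N, whose moment of order n
    tends to M(X^n) as N grows.  Their quantile functions are nondecreasing with
    values in [0, 1], and thus converge pointwise along an ultrafilter.  For
    every function of this kind, and for its powers, left Riemann sums with step
    1/K approximate the integral with error at most 1/K, so the integrals pass
    to the limit along the ultrafilter.

    Uniqueness holds because explicit polynomials, bounded by 1 on [-1, 1],
    converge there pointwise to the indicator of a given ray, so that the
    moments determine the measure of every ray ([determined_by_moments]). *)

(** * The inversion cocycle of a Coxeter group *)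

(** The semidirect product of (Z/2)^W by W, acting by conjugation.  A
    homomorphism from W to it that lifts the identity of W is the same thing as
    a cocycle with values in the subsets of W, so the universal property of a
    presentation produces such cocycles. *)
Definition signed_group (W : groupType) : Type := ((W -> bool) * W)%type.

Section SignedGroup.
Variable W : groupType.
Local Open Scope group_scope.
Local Notation G := (signed_group W).

HB.instance Definition _ := Choice.copy G ((W -> bool) * W)%type.

Definition signed_one : G := (fun=> false, 1).
Definition signed_inv (u : G) : G := (fun t => u.1 (t ^ u.2^-1), u.2^-1).
Definition signed_mul (u v : G) : G :=
  (fun t => u.1 t (+) v.1 (t ^ u.2), u.2 * v.2).

Lemma signed_mulA : associative signed_mul.
Proof.
move=> u v w; rewrite /signed_mul /= mulgA; congr pair.
by apply/funext => t; rewrite addbA conjgM.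
Qed.

Lemma signed_mul1 : left_id signed_one signed_mul.
Proof.
move=> [f w]; rewrite /signed_mul /= mul1g; congr pair.
by apply/funext => t; rewrite conjg1.
Qed.

Lemma signed_mulr1 : right_id signed_one signed_mul.
Proof.
move=> [f w]; rewrite /signed_mul /= mulg1; congr pair.
by apply/funext => t; rewrite addbF.
Qed.

Lemma signed_mulV : left_inverse signed_one signed_inv signed_mul.
Proof.
move=> [f w]; rewrite /signed_mul /= mulVg; congr pair.
by apply/funext => t; rewrite addbb.
Qed.

Lemma signed_mulVr : right_inverse signed_one signed_inv signed_mul.
Proof.
move=> [f w]; rewrite /signed_mul /= mulgV; congr pair.
by apply/funext => t; rewrite conjgK addbb.
Qed.

HB.instance Definition _ := isGroup.Build G signed_mulA signed_mul1
  signed_mulr1 signed_mulV signed_mulVr.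

Definition signed_gen (s : W) : G := (fun t => t == s, s).

(** The conjugates picked up by the 2k letters of (s t)^k are (s t)^i s for
    i < 2k.  When (s t)^k = 1 this list runs twice through the same values,
    which is why the Coxeter relations survive in the signed group. *)
Lemma signed_gen_expg (s t : W) k : s * s = 1 -> t * t = 1 ->
  (signed_gen s * signed_gen t) ^+ k =
  (fun r => \big[addb/false]_(0 <= i < k.*2) (r == (s * t) ^+ i * s),
   (s * t) ^+ k) :> G.
Proof.
move=> ss tt; have sV : s^-1 = s by exact: mulg1_eq.
have tV : t^-1 = t by exact: mulg1_eq.
elim: k => [|k IH].
  by rewrite !expg0; congr pair; apply/funext => r; rewrite big_nil.
rewrite !expgS IH; congr pair; apply/funext => r /=.
rewrite doubleS big_nat_recl// big_nat_recl// expg0 mul1g expg1 addbA.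
have conjE (x y z : W) : (x ^ y == z) = (x == z ^ y^-1).
  by rewrite (can2_eq (conjgK _) (conjgKV _)).
congr (_ (+) _ (+) _); first by rewrite conjE /conjg invgK sV mulgA.
apply: eq_bigr => i _; rewrite conjE; congr (_ == _).
by rewrite conjgE invgK invgM sV tV expgS expgSr !mulgA.
Qed.

End SignedGroup.

Section Inversions.
Variables (W : groupType) (S : set W).
Local Open Scope group_scope.

(** The characteristic function of the set of reflections that shorten x when
    they multiply it on the left; in geometric terms, of the walls that separate
    the chambers of 1 and x. *)
Definition inversion_cocycle (N : W -> W -> bool) : Prop :=
  (forall x y t, N (x * y) t = N x t (+) N y (t ^ x)) /\
  (forall s, S s -> forall t, N s t = (t == s)).

Lemma coxeter_involution : coxeter_system S -> forall s, S s -> s * s = 1.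
Proof.
move=> [_ [m [mS [rel _]]]] s Ss; have [_ _ mss] := mS s s Ss Ss.
by have := rel s s 1%N Ss Ss (mss.2 erefl); rewrite expg1.
Qed.

Lemma letter_in_generators : coxeter_system S ->
  forall s, S s \/ S s^-1 -> S s.
Proof.
move=> cS s [//|Ss]; have := coxeter_involution cS Ss.
by move=> /mulg1_eq; rewrite invgK => ->.
Qed.

Lemma coxeter_inversion_cocycle : coxeter_system S ->
  exists N, inversion_cocycle N.
Proof.
move=> cS; have inv2 := coxeter_involution cS.
have letS := letter_in_generators cS.
case: (cS) => [gen [m [mS [rel univ]]]].
have [s t k Ss St mst|h hS] := univ (signed_group W) (@signed_gen W).
  have stk : (s * t) ^+ k = 1 by exact: rel.
  rewrite signed_gen_expg ?inv2//; congr pair; last exact: stk.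
  apply/funext => r; rewrite -addnn (big_cat_nat (n := k))//= ?leq_addr//.
  rewrite -{2}[k]addn0 addnC big_addn addnK.
  under [X in _ (+) X]eq_bigr => i _ do rewrite expgnDr stk mulg1.
  exact: addbb.
have h1 : h 1 = 1 by apply: (@mulgI _ (h 1)); rewrite -gmulfM !mulg1.
have h2 w : (h w).2 = w.
  have [n [l [_ lS <-]]] := gen w; elim: l lS => [|s l IH] lS.
    by rewrite big_nil h1.
  rewrite big_cons gmulfM /= IH ?hS//; last first.
    by move=> x xl; apply: lS; rewrite inE xl orbT.
  by apply: letS; apply: lS; rewrite mem_head.
exists (fun w => (h w).1); split=> [x y t|s Ss t]; last by rewrite hS.
by rewrite gmulfM /= h2.
Qed.

Hypothesis cS : coxeter_system S.
Let inv2 := coxeter_involution cS.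

(** For l = s_1 ... s_n, the reflections u_i s_i u_i^-1 with
    u_i = s_1 ... s_(i-1).  Conjugating by s and by s^-1 is the same since s is
    an involution. *)
Fixpoint reflections (l : seq W) : seq W :=
  if l is s :: l' then s :: [seq t ^ s | t <- reflections l'] else [::].

Lemma size_reflections l : size (reflections l) = size l.
Proof. by elim: l => //= s l <-; rewrite size_map. Qed.

Lemma cocycle1 N : inversion_cocycle N -> forall t, N 1 t = false.
Proof.
move=> [NM _] t; have := NM 1 1 t; rewrite mulg1 conjg1.
by case: (N 1 t).
Qed.

Lemma cocycle_reflections N l : inversion_cocycle N ->
  (forall s, s \in l -> S s) -> uniq (reflections l) ->
  forall t, N (\prod_(s <- l) s) t = (t \in reflections l).
Proof.
move=> HN; have [NM NS] := HN; elim: l => [|s l IH] lS /=.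
  by move=> _ t; rewrite big_nil cocycle1.
have Ss : S s by apply: lS; rewrite mem_head.
have sV : s^-1 = s by apply: mulg1_eq; exact: inv2.
move=> /andP[sl ul] t; rewrite big_cons NM NS// IH; last 2 first.
- by move=> x xl; apply: lS; rewrite inE xl orbT.
- by move: ul; rewrite map_inj_uniq//; exact: conjg_inj.
have -> : (t ^ s \in reflections l) = (t \in [seq t ^ s | t <- reflections l]).
  by rewrite -{2}[t](conjgK s) sV (mem_map (@conjg_inj _ s)).
rewrite inE; by case: eqP => [->|].
Qed.

(** Multiplying by the i-th reflection of a word deletes its i-th letter. *)
Lemma exchange l t : (forall s, s \in l -> S s) -> t \in reflections l ->
  exists l', [/\ (size l' < size l)%N, (forall s, s \in l' -> S s) &
    \prod_(s <- l') s = t * \prod_(s <- l) s].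
Proof.
elim: l t => // s l IH t lS /=.
have Ss : S s by apply: lS; rewrite mem_head.
have sV : s^-1 = s by apply: mulg1_eq; exact: inv2.
have l'S x : x \in l -> S x by move=> xl; apply: lS; rewrite inE xl orbT.
rewrite inE => /orP[/eqP ->|/mapP[u ul ->]].
  by exists l; split => //; rewrite big_cons mulgA inv2// mul1g.
have [l' [sl' l'S' l'E]] := IH u l'S ul.
exists (s :: l'); split => //.
  by move=> x; rewrite inE => /orP[/eqP ->//|/l'S'].
by rewrite !big_cons l'E conjgE sV -!mulgA (mulgA s s) inv2// mul1g.
Qed.

(** A reflection that occurs twice in the list amounts to two letters that can
    both be deleted: cancel the common prefix and apply the exchange property to
    what follows the first occurrence. *)
Lemma deletion l : (forall s, s \in l -> S s) -> ~~ uniq (reflections l) ->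
  exists l', [/\ (size l' < size l)%N, (forall s, s \in l' -> S s) &
    \prod_(s <- l') s = \prod_(s <- l) s].
Proof.
elim: l => // s l IH lS /=.
have Ss : S s by apply: lS; rewrite mem_head.
have l'S x : x \in l -> S x by move=> xl; apply: lS; rewrite inE xl orbT.
rewrite negb_and negbK => /orP[/mapP[t tl st]|].
  have ts : t = s.
    apply: (@conjg_inj _ s); rewrite -st conjgE inv2// mulg1.
    by apply: esym; apply: mulg1_eq; exact: inv2.
  have [l' [sl' l'S' l'E]] := exchange l'S tl.
  exists l'; split => //; first exact: ltnW.
  by rewrite l'E big_cons ts.
rewrite map_inj_uniq; last exact: conjg_inj.
move=> /(IH l'S)[l' [sl' l'S' l'E]]; exists (s :: l'); split => //.
  by move=> x; rewrite inE => /orP[/eqP ->//|/l'S'].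
by rewrite !big_cons l'E.
Qed.

Lemma reduced_word w : exists l, [/\ size l = word_length S w,
  (forall s, s \in l -> S s), \prod_(s <- l) s = w & uniq (reflections l)].
Proof.
have [gen _] := cS; have [n wn] := gen w.
have [k [Pk mink]] : exists k, word_of_length S w k /\
    forall j, word_of_length S w j -> (k <= j)%N.
  have ex : exists k, `[< word_of_length S w k >] by exists n; apply/asboolP.
  exists (ex_minn ex); case: ex_minnP => k /asboolP Pk mink; split => // j Pj.
  by apply: mink; apply/asboolP.
have /= [] := @xgetPex _ 0%N [set n | word_of_length S w n /\
    forall k, word_of_length S w k -> (n <= k)%N] (ex_intro _ k (conj Pk mink)).
rewrite -/(word_length S w) => -[l [sl lS lE]] minl.
have {}lS s : s \in l -> S s.
  by move=> /lS; exact: letter_in_generators.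
exists l; split => //; apply/negPn/negP => /(deletion lS)[l' [sl' l'S l'E]].
suff /minl : word_of_length S w (size l') by rewrite -sl leqNgt sl'.
by exists l'; split => //; [move=> x /l'S; left|rewrite l'E].
Qed.

Lemma word_length_cocycle N w : inversion_cocycle N ->
  exists T : seq W, [/\ uniq T, size T = word_length S w &
    forall t, N w t = (t \in T)].
Proof.
move=> HN; have [l [sl lS lE ul]] := reduced_word w.
exists (reflections l); split => //; first by rewrite size_reflections.
by rewrite -lE; exact: cocycle_reflections.
Qed.

Lemma count_cocycle N w (L : seq W) : inversion_cocycle N -> uniq L ->
  (forall t, N w t -> t \in L) -> count (N w) L = word_length S w.
Proof.
move=> HN uL NL; have [T [uT sT NT]] := word_length_cocycle w HN.
rewrite -size_filter -sT; apply: perm_size; apply: uniq_perm => //.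
  exact: filter_uniq.
move=> t; rewrite mem_filter -NT; apply/andb_idr; exact: NL.
Qed.

(** By the cocycle identity, N(y^-1 x) is the image under conjugation by y of
    the symmetric difference of N(x) and N(y). *)
Lemma word_length_divl N x y (L : seq W) : inversion_cocycle N -> uniq L ->
  (forall t, N x t -> t \in L) -> (forall t, N y t -> t \in L) ->
  word_length S (y^-1 * x) = count (fun t => N x t (+) N y t) L.
Proof.
move=> HN uL xL yL; have [NM _] := HN.
have NE t : N (y^-1 * x) (t ^ y) = N x t (+) N y t.
  rewrite NM conjgK addbC; congr addb.
  by have := NM y y^-1 t; rewrite mulgV cocycle1//; do 2 case: (N _ _).
rewrite -(@count_cocycle N _ [seq t ^ y | t <- L])//; last 2 first.
- by rewrite map_inj_uniq//; exact: conjg_inj.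
- move=> t; rewrite -{1}[t](conjgKV y) NE => Nt; apply/mapP.
  exists (t ^ y^-1); last by rewrite conjgKV.
  by move: Nt; case: (boolP (N x _)) => [/xL//|_ /yL].
by rewrite count_map; apply: eq_count => t /=; exact: NE.
Qed.

(** Commuting letters are their own associated reflections, so a word in
    distinct commuting generators has pairwise distinct reflections and is
    reduced. *)
Lemma word_length_prod_commuting N (l : seq W) : inversion_cocycle N ->
  (forall s, s \in l -> S s) ->
  (forall s t, s \in l -> t \in l -> s * t = t * s) -> uniq l ->
  word_length S (\prod_(s <- l) s) = size l.
Proof.
move=> HN lS lC ul.
have rl : reflections l = l.
  elim: l lC {lS ul} => //= s l IH lC; rewrite IH; last first.
    by move=> x y xl yl; apply: lC; rewrite inE ?xl ?yl orbT.
  congr (_ :: _); apply: map_id_in => t tl.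
  by rewrite conjgE (lC t s) ?mulKg ?inE ?eqxx ?tl ?orbT.
rewrite -(@count_cocycle N _ l)//; last first.
  by move=> t; rewrite (cocycle_reflections HN) ?rl.
rewrite (@eq_in_count _ _ predT) ?count_predT// => t tl.
by rewrite (cocycle_reflections HN) ?rl.
Qed.

End Inversions.

(** * Positive definiteness over finite families *)

Lemma fsbig_setT_seq (T : choiceType) (V : nmodType) (F : seq T) (f : T -> V) :
  uniq F -> (forall x, x \notin F -> f x = 0) ->
  \sum_(x \in [set: T]) f x = \sum_(x <- F) f x.
Proof.
move=> uF f0; rewrite (fsbigE F)//; last by move=> x _; exact: f0.
by apply: eq_bigl => x; rewrite in_setT.
Qed.

Section PositiveDefinite.
Variables (R : realType) (W : groupType).
Implicit Types (phi : W -> R[i]).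

Lemma positive_definite_fsumE phi (alpha : W -> R[i]) (F : seq W) :
  uniq F -> (forall x, x \notin F -> alpha x = 0) ->
  \sum_(x \in [set: W]) \sum_(y \in [set: W])
     phi (y^-1 * x)%g * alpha x * (alpha y)^*%C =
  \sum_(x <- F) \sum_(y <- F) phi (y^-1 * x)%g * alpha x * (alpha y)^*%C.
Proof.
move=> uF aF; have E x : \sum_(y \in [set: W])
    phi (y^-1 * x)%g * alpha x * (alpha y)^*%C =
    \sum_(y <- F) phi (y^-1 * x)%g * alpha x * (alpha y)^*%C.
  by apply: fsbig_setT_seq => // y /aF ->; rewrite conjc0 mulr0.
rewrite (@fsbig_setT_seq _ _ F)//; last first.
  by move=> x /aF ax; rewrite E big1// => y _; rewrite ax mulr0 mul0r.
by apply: eq_bigr => x _; exact: E.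
Qed.

Lemma positive_definite_seq phi :
  (forall (F : seq W) (alpha : W -> R[i]), uniq F ->
     0 <= \sum_(x <- F) \sum_(y <- F)
       phi (y^-1 * x)%g * alpha x * (alpha y)^*%C) ->
  positive_definite phi.
Proof.
move=> phi_ge0 alpha /finite_seqP[F aF].
rewrite (@positive_definite_fsumE _ _ (undup F)) ?undup_uniq//.
  by apply: phi_ge0; exact: undup_uniq.
move=> x; rewrite mem_undup => /negP xF; apply/eqP/negPn/negP => ax.
by apply: xF; have : [set x | alpha x != 0] x by []; rewrite aF.
Qed.

(** The points x i may repeat: the coefficients at equal points are added up to
    form a single test function on the group. *)
Lemma positive_definite_family phi (I : eqType) (r : seq I) (x : I -> W)
    (c : I -> R[i]) : positive_definite phi ->
  0 <= \sum_(i <- r) \sum_(j <- r) phi ((x j)^-1 * x i)%g * c i * (c j)^*%C.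
Proof.
move=> pd; pose F := undup (map x r).
pose alpha w := \sum_(i <- r | x i == w) c i.
have sumE (g : W -> R[i]) (b : I -> R[i]) :
    \sum_(w <- F) g w * (\sum_(i <- r | x i == w) b i) =
    \sum_(i <- r) g (x i) * b i.
  under eq_bigr do rewrite mulr_sumr big_mkcond/=.
  rewrite exchange_big/= big_seq [RHS]big_seq; apply: eq_bigr => i ir.
  rewrite (bigD1_seq (x i))/= ?undup_uniq ?mem_undup ?map_f// eqxx.
  by rewrite big1 ?addr0// => w; rewrite eq_sym => /negbTE ->.
have alphaF w : w \notin F -> alpha w = 0.
  rewrite mem_undup => wF; rewrite /alpha big_seq_cond big1// => i.
  by move=> /andP[ir /eqP xi]; rewrite -xi map_f in wF.
have := pd alpha; rewrite (@positive_definite_fsumE _ _ F) ?undup_uniq//.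
have -> : \sum_(x <- F) \sum_(y <- F)
    phi (y^-1 * x)%g * alpha x * (alpha y)^*%C =
    \sum_(i <- r) \sum_(j <- r) phi ((x j)^-1 * x i)%g * c i * (c j)^*%C.
  under eq_bigr => w _.
    under eq_bigr => v _ do rewrite rmorph_sum/=.
    rewrite sumE.
    over.
  rewrite exchange_big/= [RHS]exchange_big/=; apply: eq_bigr => j _.
  under eq_bigr => w _ do rewrite mulrAC.
  by rewrite sumE; apply: eq_bigr => i _; rewrite mulrAC.
apply; apply: (@sub_finite_set _ _ [set` F]) => // w /=.
by apply: contraNT => /alphaF ->.
Qed.

End PositiveDefinite.

(** * Integrals of powers of a bounded function *)

Section BoundedIntegrals.
Context d (T : measurableType d) (R : realType).
Variables (P : {measure set T -> \bar R}) (D : set T).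
Hypotheses (mD : measurable D) (PD : (P D < +oo)%E).

Lemma bounded_integrable (f : T -> R) (K : R) :
  measurable_fun D f -> (forall x, D x -> `|f x| <= K) ->
  P.-integrable D (EFin \o f).
Proof.
move=> mf fK; apply: measurable_bounded_integrable => //.
exists K; split; first exact: num_real.
by move=> M KM x Dx /=; apply: le_trans (fK x Dx) (ltW KM).
Qed.

Variable f : T -> R.
Hypotheses (mf : measurable_fun D f) (f1 : forall x, D x -> `|f x| <= 1).

Lemma integrable_pow n : P.-integrable D (EFin \o (fun x => f x ^+ n)).
Proof.
apply: (@bounded_integrable _ 1); first exact: measurable_funX.
by move=> x Dx; rewrite normrX exprn_ile1// f1.
Qed.

Lemma integrable_sum_pow (I : Type) (r : seq I) (c : I -> R) (n : I -> nat) :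
  P.-integrable D (EFin \o (fun x => \sum_(i <- r) c i * f x ^+ n i)).
Proof.
apply: (@bounded_integrable _ (\sum_(i <- r) `|c i|)).
  apply: measurable_sum => i; apply: measurable_funM.
    exact: measurable_cst.
  exact: measurable_funX.
move=> x Dx; apply: le_trans (ler_norm_sum _ _ _) _; apply: ler_sum => i _.
by rewrite normrM ler_piMr// normrX exprn_ile1// f1.
Qed.

Lemma Rintegral_sum_pow (I : Type) (r : seq I) (c : I -> R) (n : I -> nat) :
  \int[P]_(x in D) (\sum_(i <- r) c i * f x ^+ n i) =
  \sum_(i <- r) c i * \int[P]_(x in D) (f x ^+ n i).
Proof.
elim: r => [|i r IH].
  under eq_Rintegral do rewrite big_nil.
  by rewrite big_nil Rintegral_cst// mul0r.
under eq_Rintegral do rewrite big_cons.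
rewrite big_cons RintegralD//; last exact: integrable_sum_pow.
  by rewrite IH RintegralZl//; exact: integrable_pow.
by have := @integrable_sum_pow I [:: i] c n; under eq_fun do rewrite big_seq1.
Qed.

Lemma integrable_horner (p : {poly R}) :
  P.-integrable D (EFin \o (fun x => p.[f x])).
Proof.
rewrite (_ : (fun x => _) = fun x => \sum_(i < size p) p`_i * f x ^+ i).
  exact: integrable_sum_pow.
by apply/funext => x; exact: horner_coef.
Qed.

Lemma Rintegral_horner (p : {poly R}) :
  \int[P]_(x in D) p.[f x] =
  \sum_(i < size p) p`_i * \int[P]_(x in D) (f x ^+ i).
Proof.
under eq_Rintegral do rewrite horner_coef.
exact: Rintegral_sum_pow.
Qed.

End BoundedIntegrals.

(** * Integrals of q ^ length are positive definite *)

Section Kernel.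
Variables (R : realType) (W : groupType).

(** Induction on the list of coordinates.  With eps x = -1 or 1 according to the
    value N x t, the factor of coordinate t is
    (1 + q) / 2 + (1 - q) / 2 * eps x * eps y; the first summand leaves alpha
    unchanged and the second replaces it by eps * alpha. *)
Lemma agreement_kernel_ge0 (T : Type) (q : R) (N : W -> T -> bool) (L : seq T)
    (F : seq W) (alpha : W -> R[i]) : -1 <= q <= 1 ->
  0 <= \sum_(x <- F) \sum_(y <- F)
    (q ^+ count (fun t => N x t (+) N y t) L)%:C%C * (alpha x * (alpha y)^*%C).
Proof.
move=> /andP[q_ge q_le]; elim: L alpha => [|t L IH] alpha /=.
  have -> : \sum_(x <- F) \sum_(y <- F)
      (q ^+ 0)%:C%C * (alpha x * (alpha y)^*%C) =
      (\sum_(x <- F) alpha x) * (\sum_(x <- F) alpha x)^*%C.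
    rewrite rmorph_sum mulr_suml; apply: eq_bigr => x _.
    by rewrite mulr_sumr; apply: eq_bigr => y _; rewrite expr0 mul1r.
  exact: mul_conjC_ge0.
pose eps x : R := if N x t then -1 else 1.
have qE x y : q ^+ (N x t (+) N y t) =
    (1 + q) / 2 + (1 - q) / 2 * (eps x * eps y).
  rewrite /eps; case: (N x t); case: (N y t);
    by rewrite /= ?expr0 ?expr1; field.
rewrite [leRHS](_ : _ =
   ((1 + q) / 2)%:C%C * (\sum_(x <- F) \sum_(y <- F)
     (q ^+ count (fun t => N x t (+) N y t) L)%:C%C * (alpha x * (alpha y)^*%C))
   + ((1 - q) / 2)%:C%C * (\sum_(x <- F) \sum_(y <- F)
     (q ^+ count (fun t => N x t (+) N y t) L)%:C%C *
       (((eps x)%:C%C * alpha x) * ((eps y)%:C%C * alpha y)^*%C))).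
  apply: addr_ge0; apply: mulr_ge0; rewrite ?IH ?lecR//.
  - by apply: divr_ge0 => //; lra.
  - by apply: divr_ge0 => //; lra.
rewrite !mulr_sumr -big_split/=; apply: eq_bigr => x _.
rewrite !mulr_sumr -big_split/=; apply: eq_bigr => y _.
have conj_realM (a : R) (z : R[i]) : (a%:C%C * z)^*%C = a%:C%C * z^*%C.
  case: z => u v; apply/eqP; rewrite eq_complex /=.
  by apply/andP; split; apply/eqP; ring.
rewrite conj_realM exprD qE !(rmorphM (real_complex R)) rmorphD/=.
rewrite !(rmorphM (real_complex R))/=; ring.
Qed.

End Kernel.

Section Sufficiency.
Variables (R : realType) (W : groupType) (S : set W).
Hypothesis cS : coxeter_system S.

Lemma integrated_kernel_ge0 (mu : probability (measurableTypeR R) R)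
    (I : Type) (r : seq I) (c : I -> R) (n : I -> nat) :
  (forall q, -1 <= q <= 1 -> 0 <= \sum_(i <- r) c i * q ^+ n i) ->
  0 <= \sum_(i <- r) c i * \int[mu]_(q in `[-1, 1]%classic) (q ^+ n i).
Proof.
move=> c_ge0; rewrite -Rintegral_sum_pow//=.
- by apply: Rintegral_ge0 => q; rewrite /= in_itv/=; exact: c_ge0.
- by apply: le_lt_trans (probability_le1 _ _) (ltry 1).
- by move=> q /=; rewrite in_itv/= ler_norml.
Qed.

Lemma Re_sum (I : Type) (r : seq I) (F : I -> R[i]) :
  complex.Re (\sum_(i <- r) F i) = \sum_(i <- r) complex.Re (F i).
Proof. by elim/big_rec2: _ => //= i x [a b] _ <-; case: (F i). Qed.

Lemma Im_sum (I : Type) (r : seq I) (F : I -> R[i]) :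
  complex.Im (\sum_(i <- r) F i) = \sum_(i <- r) complex.Im (F i).
Proof. by elim/big_rec2: _ => //= i x [a b] _ <-; case: (F i). Qed.

Lemma Re_realM (a : R) (z : R[i]) : complex.Re (a%:C%C * z) = complex.Re z * a.
Proof. by case: z => x y /=; ring. Qed.

Lemma Im_realM (a : R) (z : R[i]) : complex.Im (a%:C%C * z) = complex.Im z * a.
Proof. by case: z => x y /=; ring. Qed.

Lemma complex_ge0P (z : R[i]) :
  0 <= z <-> complex.Im z = 0 /\ 0 <= complex.Re z.
Proof.
rewrite lecE/=; split=> [/andP[/eqP->]//|[-> ->]].
by rewrite eqxx.
Qed.

(** The quadratic form is the integral over q of the quadratic forms of the
    kernels q^|y^-1 x|.  Real and imaginary parts are integrated separately: the
    former is nonnegative for each q and the latter vanishes for each q. *)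
Lemma represents_positive_definite (phi : W -> R[i])
    (mu : probability (measurableTypeR R) R) :
  represents S phi mu -> positive_definite phi.
Proof.
move=> [_ phiE]; apply: positive_definite_seq => F alpha uF.
have [N HN] := coxeter_inversion_cocycle cS.
pose T x := projT1 (cid (word_length_cocycle cS x HN)).
pose L := undup (flatten (map T F)).
have NL x : x \in F -> forall t, N x t -> t \in L.
  move=> xF t; rewrite /L mem_undup.
  have [_ _ ->] := projT2 (cid (word_length_cocycle cS x HN)) => tx.
  by apply/flattenP; exists (T x) => //; exact: map_f.
pose D x y := count (fun t => N x t (+) N y t) L.
have lenE x y : x \in F -> y \in F -> word_length S (y^-1 * x)%g = D x y.
  move=> xF yF; apply: word_length_divl => //; first exact: undup_uniq.
    exact: NL.
  exact: NL.
pose r := [seq (x, y) | x <- F, y <- F].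
pose c p := alpha p.1 * (alpha p.2)^*%C.
have sumE (g : W -> W -> R[i]) :
    \sum_(x <- F) \sum_(y <- F) g x y * (alpha x * (alpha y)^*%C) =
    \sum_(p <- r) g p.1 p.2 * c p.
  by rewrite big_allpairs.
pose m n := \int[mu]_(q in `[-1, 1]%classic) (q ^+ n).
have -> : \sum_(x <- F) \sum_(y <- F)
    phi (y^-1 * x)%g * alpha x * (alpha y)^*%C =
    \sum_(p <- r) (m (D p.1 p.2))%:C%C * c p.
  rewrite -(sumE (fun x y => (m (D x y))%:C%C)).
  rewrite big_seq [RHS]big_seq; apply: eq_bigr => x xF.
  rewrite big_seq [RHS]big_seq; apply: eq_bigr => y yF.
  by rewrite phiE lenE// mulrA.
have pos q : -1 <= q <= 1 ->
    \sum_(p <- r) complex.Im (c p) * q ^+ D p.1 p.2 = 0 /\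
    0 <= \sum_(p <- r) complex.Re (c p) * q ^+ D p.1 p.2.
  move=> q1; have := agreement_kernel_ge0 N L F alpha q1.
  rewrite (sumE (fun x y => (q ^+ D x y)%:C%C)).
  move/complex_ge0P; rewrite Re_sum Im_sum.
  under eq_bigr do rewrite Im_realM.
  by under [X in _ /\ 0 <= X -> _]eq_bigr do rewrite Re_realM.
apply/complex_ge0P; rewrite Re_sum Im_sum; split; last first.
  under eq_bigr do rewrite Re_realM.
  by apply: integrated_kernel_ge0 => q /pos[].
under eq_bigr do rewrite Im_realM.
apply/eqP; rewrite eq_le; apply/andP; split; last first.
  by apply: integrated_kernel_ge0 => q /pos[->].
rewrite -oppr_ge0 -sumrN; under eq_bigr do rewrite -mulNr.
apply: integrated_kernel_ge0 => q /pos[q0 _].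
by under eq_bigr do rewrite mulNr; rewrite sumrN q0 oppr0.
Qed.

End Sufficiency.

(** * Moments of Bernstein weights *)

Section FactorialMoments.

(** The factorial moments of the binomial distribution, with success and failure
    weights x and z left free. *)
Lemma sum_ffact_binomial (K : comNzRingType) (x z : K) N j :
  \sum_(k < N.+1) (k ^_ j)%:R * ('C(N, k)%:R * x ^+ k * z ^+ (N - k)) =
  (N ^_ j)%:R * x ^+ j * (x + z) ^+ (N - j).
Proof.
elim: j N => [|j IH] N.
  rewrite ffactn0 !mul1r subn0 addrC exprDn; apply: eq_bigr => k _.
  by rewrite ffactn0 mul1r -[RHS]mulr_natl; ring.
case: N => [|N].
  by rewrite big_ord1 ffact0n/= !mul0r.
rewrite big_ord_recl ffact0n/= mul0r add0r ffactSS subSS.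
have -> : ((N.+1 * N ^_ j)%:R * x ^+ j.+1 * (x + z) ^+ (N - j)) =
    N.+1%:R * x * ((N ^_ j)%:R * x ^+ j * (x + z) ^+ (N - j)).
  by rewrite natrM exprS; ring.
rewrite -IH mulr_sumr; apply: eq_bigr => k _.
rewrite /bump/= add1n ffactSS subSS exprS natrM.
have -> : k.+1%:R * (k ^_ j)%:R *
      ('C(N.+1, k.+1)%:R * (x * x ^+ k) * z ^+ (N - k)) =
    (k ^_ j)%:R *
      ((k.+1 * 'C(N.+1, k.+1))%:R * (x * x ^+ k) * z ^+ (N - k)) :> K.
  by rewrite natrM; ring.
by rewrite -mul_bin_diag natrM/=; ring.
Qed.

Variable R : realType.
Variable M : {linear {poly R} -> R^o}.
Hypothesis M1 : M 1 = 1.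
Hypothesis M_ge0 : forall k l, 0 <= M ('X ^+ k * (1 - 'X) ^+ l).

(** The value of M at the k-th Bernstein polynomial of degree N.  If M is the
    integral against a law on [0, 1], this is the probability of k successes in
    N trials whose success probability is drawn from that law. *)
Definition bernstein_weight N k : R :=
  M ('C(N, k)%:R * 'X ^+ k * (1 - 'X) ^+ (N - k)).

Lemma bernstein_weight_ge0 N k : 0 <= bernstein_weight N k.
Proof. by rewrite /bernstein_weight -mulrA mulr_natl linearMn mulrn_wge0. Qed.

Lemma sum_ffact_weight N j :
  \sum_(k < N.+1) (k ^_ j)%:R * bernstein_weight N k = (N ^_ j)%:R * M 'X^j.
Proof.
have := sum_ffact_binomial ('X : {poly R}) (1 - 'X) N j.
rewrite [X in X ^+ (N - j)]addrC subrK expr1n mulr1 => /(congr1 M).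
rewrite linear_sum mulr_natl linearMn mulr_natl => <-; apply: eq_bigr => k _.
by rewrite mulr_natl [in RHS]mulr_natl linearMn.
Qed.

Lemma sum_bernstein_weight N : \sum_(k < N.+1) bernstein_weight N k = 1.
Proof.
have := sum_ffact_weight N 0; rewrite ffactn0 mul1r expr0 M1 => <-.
by apply: eq_bigr => k _; rewrite ffactn0 mul1r.
Qed.

Lemma cvg_ffact_ratio j :
  ((n.+1 ^_ j)%:R / n.+1%:R ^+ j : R) @[n --> \oo] --> (1 : R).
Proof.
elim: j => [|j IH].
  by under eq_fun do rewrite ffactn0 expr0 divr1; exact: cvg_cst.
have -> : (fun n => (n.+1 ^_ j.+1)%:R / n.+1%:R ^+ j.+1 : R) =
    (fun n => (n.+1 ^_ j)%:R / n.+1%:R ^+ j * (1 - j%:R * harmonic n)).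
  apply/funext => n; have n0 : n.+1%:R != 0 :> R by rewrite pnatr_eq0.
  rewrite ffactnSr natrM exprS /harmonic.
  have -> : (n.+1 ^_ j)%:R * (n.+1 - j)%:R =
      (n.+1 ^_ j)%:R * (n.+1%:R - j%:R) :> R.
    have [jn|nj] := leqP j n.+1; first by rewrite natrB.
    by rewrite ffact_small// !mul0r.
  by rewrite /=; field; rewrite expf_neq0// -natr1 addrC in n0 *; rewrite n0.
rewrite -[1 in X in _ --> X](mulr1 1); apply: cvgM => //.
rewrite -[X in _ --> X](subr0 1); apply: cvgB; first exact: cvg_cst.
rewrite -(mulr0 j%:R); apply: cvgM; first exact: cvg_cst.
exact: cvg_harmonic.
Qed.

(** Falling factorial moments of the weights are exactly known, ordinary moments
    are not.  Mixed moments allow to trade one for the other, one factor at a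
    time: k * k^_j = k^_(j+1) + j * k^_j, and the last term is negligible after
    division by N. *)
Lemma cvg_mixed_moment n j :
  \sum_(k < N.+2) (k ^_ j)%:R * k%:R ^+ n * bernstein_weight N.+1 k
    / N.+1%:R ^+ (j + n) @[N --> \oo] --> (M 'X^(j + n) : R).
Proof.
elim: n j => [|n IH] j.
  rewrite addn0; have -> : (fun N => \sum_(k < N.+2) (k ^_ j)%:R * k%:R ^+ 0 *
      bernstein_weight N.+1 k / N.+1%:R ^+ j) =
      (fun N => (N.+1 ^_ j)%:R / N.+1%:R ^+ j * (M 'X^j : R)).
    apply/funext => N; rewrite -mulr_suml.
    under eq_bigr do rewrite expr0 mulr1.
    by rewrite sum_ffact_weight mulrAC.
  rewrite -[X in _ --> X]mul1r; apply: cvgM; last exact: cvg_cst.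
  exact: cvg_ffact_ratio.
have -> : (fun N => \sum_(k < N.+2) (k ^_ j)%:R * k%:R ^+ n.+1 *
    bernstein_weight N.+1 k / N.+1%:R ^+ (j + n.+1)) =
  (fun N => \sum_(k < N.+2) (k ^_ j.+1)%:R * k%:R ^+ n *
    bernstein_weight N.+1 k / N.+1%:R ^+ (j.+1 + n) +
    j%:R * harmonic N * \sum_(k < N.+2) (k ^_ j)%:R * k%:R ^+ n *
    bernstein_weight N.+1 k / N.+1%:R ^+ (j + n)).
  apply/funext => N; rewrite mulr_sumr -big_split/=; apply: eq_bigr => k _.
  have N0 : N.+1%:R != 0 :> R by rewrite pnatr_eq0.
  rewrite addnS addSn ffactnSr natrM /harmonic/= !exprS.
  have -> : (k ^_ j)%:R * (k - j)%:R = (k ^_ j)%:R * (k%:R - j%:R) :> R.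
    have [jk|kj] := leqP j k; first by rewrite natrB.
    by rewrite ffact_small// !mul0r.
  field; rewrite expf_neq0//=; lra.
rewrite addnS -addSn -[X in _ --> X]addr0; apply: cvgD; first exact: IH.
rewrite -[X in _ --> X](mul0r (M 'X^(j + n) : R)); apply: cvgM; last exact: IH.
rewrite -[X in _ --> X](mulr0 j%:R); apply: cvgM; first exact: cvg_cst.
exact: cvg_harmonic.
Qed.

Lemma cvg_bernstein_moment n :
  \sum_(k < N.+2) (k%:R / N.+1%:R) ^+ n * bernstein_weight N.+1 k @[N --> \oo]
    --> (M 'X^n : R).
Proof.
rewrite -[n in X in _ --> X]add0n; apply: (cvg_trans _ (@cvg_mixed_moment n 0)).
apply: near_eq_cvg; apply: nearW => N; apply: eq_bigr => k _.
by rewrite ffactn0 mul1r expr_div_n mulrAC.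
Qed.

End FactorialMoments.

(** * Quantile functions and the uniform law *)

Section StepQuantile.
Variables (R : realType) (n : nat) (p : nat -> R).
Hypothesis p_ge0 : forall k, 0 <= p k.

Definition cumul k : R := \sum_(j < k) p j.

(** The quantile function of the probability on the points k / n with weights
    p k, for k <= n: a sum of steps rather than an infimum, which makes
    monotonicity and bounds immediate. *)
Definition quantile (u : R) : R := (\sum_(k < n) (cumul k.+1 < u)%R%:R) / n%:R.

Lemma cumul0 : cumul 0 = 0. Proof. exact: big_ord0. Qed.

Lemma cumulS k : cumul k.+1 = cumul k + p k. Proof. exact: big_ord_recr. Qed.

Lemma cumul_le j k : (j <= k)%N -> cumul j <= cumul k.
Proof.
by apply: (homo_leq (@lexx _ _) (@le_trans _ _)) => i; rewrite cumulS lerDl.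
Qed.

Lemma quantile_nondecreasing : {homo quantile : u v / u <= v}.
Proof.
move=> u v uv; rewrite /quantile ler_wpM2r ?invr_ge0// ler_sum// => k _.
by rewrite ler_nat; case: (ltP _ u) => //= cu; rewrite (lt_le_trans cu uv).
Qed.

Lemma quantile_ge0 u : 0 <= quantile u.
Proof. by rewrite divr_ge0// sumr_ge0. Qed.

Lemma quantile_le1 u : quantile u <= 1.
Proof.
rewrite /quantile; have [->|n0] := posnP n; first by rewrite big_ord0 mul0r.
rewrite ler_pdivrMr ?ltr0n// mul1r.
rewrite [leRHS](_ : _ = \sum_(k < n) 1); last by rewrite sumr_const card_ord.
by apply: ler_sum => k _; case: (_ < _).
Qed.

Lemma quantile_step k u : (k <= n)%N -> cumul k < u <= cumul k.+1 ->
  quantile u = k%:R / n%:R.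
Proof.
move=> kn /andP[ku uk]; rewrite /quantile; congr (_ / _).
under eq_bigr => j _.
  have -> : (cumul j.+1 < u) = (j < k)%N.
    have [jk|kj] := ltnP j k; first by apply: le_lt_trans ku; exact: cumul_le.
    by apply/negbTE; rewrite -leNgt; apply: le_trans uk _; exact: cumul_le.
  over.
rewrite -natr_sum; congr (_%:R).
rewrite (eq_bigr (fun j : 'I_n => if (j < k)%N then 1%N else 0%N)); last first.
  by move=> j _; case: ltnP.
by rewrite -big_mkcond (big_ord_narrow kn) sum1_card card_ord.
Qed.

End StepQuantile.

Section UniformIntegral.
Variable R : realType.

Definition uniform01 : probability (measurableTypeR R) R :=
  uniform_prob (@ltr01 R).

Lemma uniform01_itv (a b : R) : 0 <= a -> a <= b -> b <= 1 ->
  uniform01 `]a, b]%classic = (b - a)%:E.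
Proof.
move=> a0 ab b1; rewrite /uniform01/= /uniform_prob.
transitivity (\int[lebesgue_measure]_(x in `]a, b]%classic) (cst 1%:E x))%E.
  apply: eq_integral => x; rewrite inE/= in_itv/= => /andP[ax xb].
  rewrite /uniform_pdf (_ : _ <= _ <= _) ?subr0 ?invr1//.
  by rewrite (le_trans a0 (ltW ax)) (le_trans xb b1).
rewrite integral_cst//= mul1e lebesgue_measure_itv/= lte_fin.
by case: ltgtP ab => // ->; rewrite subrr.
Qed.

Variables (g : R -> R) (K : R).
Hypotheses (mg : measurable_fun [set: measurableTypeR R] g)
  (gK : forall u, `|g u| <= K).

Lemma uniform01_integrable (D : set (measurableTypeR R)) : measurable D ->
  uniform01.-integrable D (EFin \o g).
Proof.
move=> mD; apply: (@bounded_integrable _ _ _ _ _ _ _ _ K) => //.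
- by apply: le_lt_trans (probability_le1 _ _) (ltry 1).
- exact: measurable_funTS.
Qed.

(** The uniform law does not charge the complement of ]0, 1]. *)
Lemma uniform01_integral_setT :
  \int[uniform01]_u g u = \int[uniform01]_(u in `]0, 1]%classic) g u.
Proof.
rewrite /Rintegral (@negligible_integral _ _ _ _ _
  (~` (`]0, 1]%classic : set (measurableTypeR R))))//.
- by rewrite setDE setCK setTI.
- exact: measurableC.
- exact: uniform01_integrable.
- transitivity (1 - uniform01 `]0%R, 1%R]%classic)%E.
    exact: probability_setC.
  by rewrite uniform01_itv// subr0 subee.
Qed.

Lemma uniform01_integral_steps (t l h : nat -> R) n :
  t 0%N = 0 -> t n = 1 -> (forall i, t i <= t i.+1) ->
  (forall i u, (i < n)%N -> t i < u <= t i.+1 -> l i <= g u <= h i) ->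
  \sum_(i < n) l i * (t i.+1 - t i) <= \int[uniform01]_u g u
    <= \sum_(i < n) h i * (t i.+1 - t i).
Proof.
move=> t0 tn tS lgh.
have t_le j k : (j <= k)%N -> t j <= t k.
  exact: (homo_leq (@lexx _ _) (@le_trans _ _)).
suff /(_ n (leqnn n)) : forall m, (m <= n)%N ->
    \sum_(i < m) l i * (t i.+1 - t i)
    <= \int[uniform01]_(u in `]0, t m]%classic) g u
    <= \sum_(i < m) h i * (t i.+1 - t i) by rewrite uniform01_integral_setT tn.
elim=> [_|m IH mn].
  by rewrite !big_ord0 t0 set_itvoc0 Rintegral_set0 lexx.
have tmn : t m.+1 <= 1 by rewrite -tn t_le.
have tm0 : 0 <= t m by rewrite -t0 t_le.
rewrite !big_ord_recr/=.
have -> : `]0, t m.+1]%classic = `]0, t m]%classic `|` `]t m, t m.+1]%classic.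
  by rewrite -itv_bndbnd_setU// bnd_simp ?tm0 ?tS.
rewrite Rintegral_setU//; last 2 first.
- by apply: uniform01_integrable; exact: measurableU.
- rewrite disj_set2E; apply/eqP; rewrite -subset0 => u [/=].
  by rewrite !in_itv/= => /andP[_ utm] /andP[]; rewrite ltNge utm.
have intI c :
    \int[uniform01]_(u in `]t m, t m.+1]%classic) c = c * (t m.+1 - t m).
  rewrite Rintegral_cst//; congr (_ * _).
  exact: (congr1 fine (uniform01_itv tm0 (tS m) tmn)).
have intc c :
    uniform01.-integrable `]t m, t m.+1]%classic (EFin \o (fun=> c : R)).
  apply: (@bounded_integrable _ _ _ _ _ _ _ _ `|c|) => //.
  by apply: le_lt_trans (probability_le1 _ _) (ltry 1).
have /andP[IHl IHh] := IH (ltnW mn); apply/andP; split; apply: lerD => //.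
- rewrite -intI; apply: le_Rintegral => //; first exact: uniform01_integrable.
  by move=> u; rewrite /= in_itv/= => /(lgh m u mn)/andP[].
- rewrite -intI; apply: le_Rintegral => //; first exact: uniform01_integrable.
  by move=> u; rewrite /= in_itv/= => /(lgh m u mn)/andP[].
Qed.

End UniformIntegral.

(** * The Hausdorff moment problem *)

Section Hausdorff.
Variable R : realType.

Definition left_riemann_sum (f : R -> R) (n : nat) : R :=
  \sum_(i < n.+1) f (i%:R / n.+1%:R) / n.+1%:R.

(** The difference between the right and the left Riemann sums telescopes to
    (f 1 - f 0) / n.+1. *)
Lemma left_riemann_sum_bound (f : R -> R) (n : nat) :
  {homo f : u v / u <= v} -> (forall u, 0 <= f u <= 1) ->
  left_riemann_sum f n <= \int[uniform01 R]_u f u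
    <= left_riemann_sum f n + n.+1%:R^-1.
Proof.
move=> f_nd f01; pose t i : R := i%:R / n.+1%:R.
have n0 : 0 < n.+1%:R :> R by rewrite ltr0n.
have mf : measurable_fun [set: measurableTypeR R] f.
  exact: nondecreasing_measurable.
have fK u : `|f u| <= 1 by have /andP[f0 f1] := f01 u; rewrite ger0_norm.
have tB i : t i.+1 - t i = n.+1%:R^-1.
  by rewrite /t -mulrBl -natrB// subSnn mul1r.
have := @uniform01_integral_steps R f 1 mf fK t (f \o t) (f \o t \o S) n.+1.
have tS i : t i <= t i.+1 by rewrite -subr_ge0 tB invr_ge0 ltW.
have -> : \sum_(i < n.+1) (f \o t) i * (t i.+1 - t i) = left_riemann_sum f n.
  by apply: eq_bigr => i _; rewrite tB.
move=> H; have /andP[lo hi] : left_riemann_sum f n <= \int[uniform01 R]_u f u <=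
    \sum_(i < n.+1) (f \o t \o S) i * (t i.+1 - t i).
  apply: H => //; first by rewrite /t mul0r.
    by rewrite /t divff// gt_eqF.
  by move=> i u _ /andP[tu ut] /=; rewrite !f_nd// ltW.
rewrite lo /=; apply: (le_trans hi); rewrite -lerBlDl -sumrB.
under eq_bigr do rewrite tB -mulrBl.
rewrite -mulr_suml -(big_mkord xpredT (fun i => f (t i.+1) - f (t i))).
rewrite telescope_sumr// ler_piMl ?invr_ge0 ?(ltW n0)//.
have /andP[f0 _] := f01 (t 0%N); have /andP[_ f1] := f01 (t n.+1).
by rewrite lerBlDr (le_trans f1)// lerDl.
Qed.

(** A cluster point exists by compactness of [0, 1], and along an ultrafilter a
    cluster point is a limit.  As U does not depend on the family x, one
    ultrafilter serves all points of a sequence of functions at once. *)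
Lemma ultra_bounded_cvg (T : Type) (U : set_system T) (x : T -> R) :
  UltraFilter U -> (forall i, 0 <= x i <= 1) ->
  exists l : R, x i @[i --> U] --> l.
Proof.
move=> UU x01.
have UI : U (x @^-1` `[0, 1]%classic).
  by apply: filterE => i; rewrite /= in_itv/=.
have [l [_ lx]] := @segment_compact R 0 1 (x @ U) _ UI.
exists l => B Bl; have [//|UC] := in_ultra_setVsetC (x @^-1` B) UU.
by have [y []] := lx (~` B) B UC Bl.
Qed.

Lemma cvg_left_riemann_sum (T : Type) (U : set_system T) (FU : Filter U)
    (g : T -> R -> R) (h : R -> R) (k n : nat) :
  (forall u, g i u @[i --> U] --> h u) ->
  left_riemann_sum (fun u => g i u ^+ k) n @[i --> U]
    --> left_riemann_sum (fun u => h u ^+ k) n.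
Proof.
move=> gh; rewrite /left_riemann_sum.
apply: cvg_big => [|i _]; first exact: add_continuous.
apply: cvgM; last exact: cvg_cst.
apply: (@continuous_cvg _ _ _ _ _ _ (fun x : R => x ^+ k)); last exact: gh.
exact: exprn_continuous.
Qed.

(** Hausdorff's theorem, with the representing measure given as the law of a
    monotone function Q of a uniform variable.  Q is an ultrafilter limit of the
    quantile functions of the Bernstein weights; dominated convergence fails
    along ultrafilters, and the uniform Riemann sum estimate for monotone
    functions replaces it. *)
Theorem hausdorff_moment (M : {linear {poly R} -> R^o}) : M 1 = 1 ->
  (forall k l, 0 <= M ('X ^+ k * (1 - 'X) ^+ l)) ->
  exists Q : R -> R, [/\ {homo Q : u v / u <= v}, forall u, 0 <= Q u <= 1 &
    forall k, M 'X^k = \int[uniform01 R]_u (Q u ^+ k)].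
Proof.
move=> M1 M_ge0; pose p N := bernstein_weight M N.+1.
have p_ge0 N k : 0 <= p N k by exact: bernstein_weight_ge0.
pose g N := quantile N.+1 (p N).
have g01 N u : 0 <= g N u <= 1 by rewrite quantile_ge0// quantile_le1.
have g_nd N : {homo g N : u v / u <= v} by exact: quantile_nondecreasing.
have pow_nd k (f : R -> R) : {homo f : u v / u <= v} ->
    (forall u, 0 <= f u <= 1) -> {homo (fun u => f u ^+ k) : u v / u <= v}.
  move=> f_nd f01 u v uv; have /andP[fu _] := f01 u; have /andP[fv _] := f01 v.
  by rewrite lerXn2r ?nnegrE// f_nd.
have pow01 k (f : R -> R) : (forall u, 0 <= f u <= 1) ->
    forall u, 0 <= f u ^+ k <= 1.
  by move=> f01 u; have /andP[f0 f1] := f01 u; rewrite exprn_ge0// exprn_ile1.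
(* On the k-th step of the cumulative weights the quantile function is k / N. *)
have int_g N k : \int[uniform01 R]_u (g N u ^+ k) =
    \sum_(j < N.+2) (j%:R / N.+1%:R) ^+ k * p N j.
  have gk01 := pow01 k _ (g01 N).
  have mg : measurable_fun [set: measurableTypeR R] (fun u => g N u ^+ k).
    by apply: nondecreasing_measurable => //; exact: pow_nd.
  have gK u : `|g N u ^+ k| <= 1.
    by have /andP[? ?] := gk01 u; rewrite ger0_norm.
  have c1 : cumul (p N) N.+2 = 1 by exact: sum_bernstein_weight.
  have := uniform01_integral_steps mg gK (cumul0 _) c1.
  move=> /(_ (fun j => (j%:R / N.+1%:R) ^+ k) (fun j => (j%:R / N.+1%:R) ^+ k)).
  under eq_bigr do rewrite cumulS addrAC subrr add0r.
  move=> H; apply/esym/eqP; rewrite eq_le; apply: H.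
    by move=> i; rewrite cumulS lerDl.
  by move=> i u iN ui; rewrite -(quantile_step (p_ge0 N) _ ui)// lexx.
have [U [UU ooU]] := ultraFilterLemma eventually_filter.
pose Q u := projT1 (cid (ultra_bounded_cvg UU (fun N => g01 N u))).
have gQ u : g N u @[N --> U] --> Q u.
  exact: projT2 (cid (ultra_bounded_cvg UU (fun N => g01 N u))).
have Q01 u : 0 <= Q u <= 1.
  apply/andP; split.
    apply: (ler_cvg_to (cvg_cst 0) (gQ u)); apply: nearW => N.
    by have /andP[] := g01 N u.
  apply: (ler_cvg_to (gQ u) (cvg_cst (1 : R))); apply: nearW => N.
  by have /andP[] := g01 N u.
have Q_nd : {homo Q : u v / u <= v}.
  move=> u v uv; apply: (ler_cvg_to (gQ u) (gQ v)); apply: nearW => N.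
  exact: g_nd.
exists Q; split => // k.
have Mk : \int[uniform01 R]_u (g N u ^+ k) @[N --> U] --> (M 'X^k : R).
  rewrite (_ : (fun N => _) = fun N => \sum_(j < N.+2) (j%:R / N.+1%:R) ^+ k *
      bernstein_weight M N.+1 j); last by apply/funext => N; exact: int_g.
  by move=> A /cvg_bernstein_moment MA; exact: ooU.
have dist_le n : `|(M 'X^k : R) - \int[uniform01 R]_u (Q u ^+ k)| <= n.+1%:R^-1.
  have /andP[lo hi] :=
    left_riemann_sum_bound n (pow_nd k _ Q_nd Q01) (pow01 k _ Q01).
  have gs : left_riemann_sum (fun u => g N u ^+ k) n @[N --> U]
      --> left_riemann_sum (fun u => Q u ^+ k) n by exact: cvg_left_riemann_sum.
  have Mlo : left_riemann_sum (fun u => Q u ^+ k) n <= M 'X^k.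
    apply: (ler_cvg_to gs Mk); apply: nearW => N.
    by have /andP[] := left_riemann_sum_bound n (pow_nd k _ (g_nd N) (g01 N))
      (pow01 k _ (g01 N)).
  have Mhi : M 'X^k <= left_riemann_sum (fun u => Q u ^+ k) n + n.+1%:R^-1.
    apply: (ler_cvg_to Mk (cvgD gs (cvg_cst _))); apply: nearW => N.
    by have /andP[] := left_riemann_sum_bound n (pow_nd k _ (g_nd N) (g01 N))
      (pow01 k _ (g01 N)).
  rewrite ler_norml; move: lo hi Mlo Mhi.
  move: (M 'X^k : R) (\int[uniform01 R]_u (Q u ^+ k)) n.+1%:R^-1.
  move: (left_riemann_sum _ _) => s m I e lo hi Mlo Mhi.
  by apply/andP; split; lra.
apply/eqP; rewrite -subr_eq0 -normr_le0.
apply: (ler_cvg_to (cvg_cst _) (@cvg_harmonic R)); apply: nearW => n.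
exact: dist_le.
Qed.

End Hausdorff.

(** * The moment functional of a radial function *)

Section MomentFunctional.
Variables (R : realType) (a : nat -> R).

Definition moment_functional (p : {poly R}) : R^o :=
  \sum_(i < size p) p`_i * a i.

(** Summing up to a common bound on the sizes turns linearity into a
    coefficientwise identity. *)
Lemma moment_functional_wide n (p : {poly R}) : (size p <= n)%N ->
  moment_functional p = \sum_(i < n) p`_i * a i.
Proof.
move=> pn; rewrite /moment_functional.
rewrite (big_ord_widen n (fun i => p`_i * a i) pn) big_mkcond/=.
by apply: eq_bigr => i _; case: ltnP => // ni; rewrite nth_default ?mul0r.
Qed.

Lemma moment_functional_linear : linear moment_functional.
Proof.
move=> c p q; pose n := maxn (size (c *: p + q)) (maxn (size p) (size q)).
rewrite !(@moment_functional_wide n) ?leq_max ?leqnn ?orbT//.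
rewrite scaler_sumr -big_split/=; apply: eq_bigr => i _.
by rewrite coefD coefZ mulrDl /GRing.scale/= mulrA.
Qed.

HB.instance Definition _ := GRing.isLinear.Build R {poly R} R^o *:%R
  moment_functional moment_functional_linear.

Lemma moment_functionalXn n : moment_functional 'X^n = a n.
Proof.
rewrite /moment_functional size_polyXn (bigD1 ord_max)//= coefXn eqxx mul1r.
rewrite big1 ?addr0// => i; rewrite -val_eqE/= => /negbTE.
by rewrite coefXn => ->; rewrite mul0r.
Qed.

End MomentFunctional.

Section SubsetSums.
Variable R : realType.
Implicit Types (n : nat) (e : nat -> R).

Fixpoint subsets n : seq (seq nat) :=
  if n is n'.+1 then subsets n' ++ [seq n' :: A | A <- subsets n']
  else [:: [::]].

Lemma subsets_uniq n A : A \in subsets n ->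
  uniq A /\ forall i, i \in A -> (i < n)%N.
Proof.
elim: n A => [|n IH] A /=; first by rewrite inE => /eqP ->.
rewrite mem_cat => /orP[/IH[uA An]|/mapP[B /IH[uB Bn] ->]].
  by split=> // i /An /ltnW.
split=> [/=|i].
  by rewrite uB andbT; apply/negP => /Bn; rewrite ltnn.
by rewrite inE => /orP[/eqP ->//|/Bn /ltnW].
Qed.

Definition sign_prod e (A : seq nat) : R := \prod_(i <- A) e i.

(** Expansion of the product by choosing, for each i, the term 1 or e i X. *)
Lemma sum_subsets_poly e n :
  \sum_(A <- subsets n) sign_prod e A *: 'X^(size A) =
  \prod_(i < n) (1 + e i *: 'X) :> {poly R}.
Proof.
elim: n => [|n IH].
  by rewrite big_seq1 big_ord0 /sign_prod big_nil scale1r.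
rewrite big_ord_recr/= big_cat/= big_map IH mulrDr mulr1; congr (_ + _).
rewrite -IH mulr_suml; apply: eq_bigr => A _.
by rewrite /sign_prod big_cons -scalerAl -scalerAr scalerA mulrC exprSr.
Qed.

Section Commuting.
Variables (W : groupType) (s : nat -> W).
Hypothesis s_comm : forall i j, (s i * s j = s j * s i)%g.
Hypothesis s_inv : forall i, (s i * s i = 1)%g.

Definition subset_prod (A : seq nat) : W := (\prod_(i <- A) s i)%g.

Lemma subset_prod_comm A i : (subset_prod A * s i = s i * subset_prod A)%g.
Proof.
rewrite /subset_prod; elim: A => [|j A IH].
  by rewrite big_nil mulg1 mul1g.
by rewrite big_cons -mulgA IH !mulgA s_comm.
Qed.

(** Subsets form a group under symmetric difference, on which both sign_prod e
    and subset_prod s are homomorphisms; each value of the difference of A and B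
    is attained 2^n times.  By induction on n, the generator s n enters through
    the translate psin of psi. *)
Lemma sum_subset_pairs e n (psi : W -> R) : (forall i, e i * e i = 1) ->
  \sum_(A <- subsets n) \sum_(B <- subsets n)
    psi ((subset_prod B)^-1 * subset_prod A)%g *
      (sign_prod e A * sign_prod e B) =
  2 ^+ n * \sum_(A <- subsets n) psi (subset_prod A) * sign_prod e A.
Proof.
move=> e2; elim: n psi => [|n IH] psi.
  rewrite !big_seq1 /subset_prod /sign_prod !big_nil.
  by rewrite invg1 mulg1 expr0 !mulr1 mul1r.
have sV i : (s i)^-1%g = s i by exact: mulg1_eq.
(* As s n is an involution commuting with the other generators, it survives only
   when n belongs to exactly one of A and B. *)
have shift A B : ((subset_prod B)^-1 * subset_prod (n :: A) =
    (subset_prod B)^-1 * subset_prod A * s n)%g.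
  by rewrite /subset_prod big_cons -/(subset_prod A) -subset_prod_comm mulgA.
have shiftV A B : ((subset_prod (n :: B))^-1 * subset_prod A =
    (subset_prod B)^-1 * subset_prod A * s n)%g.
  rewrite {1}/subset_prod big_cons -/(subset_prod B) invgM sV -!mulgA.
  by rewrite subset_prod_comm.
have shift2 A B : ((subset_prod (n :: B))^-1 * subset_prod (n :: A) =
    (subset_prod B)^-1 * subset_prod A)%g.
  by rewrite shift shiftV -!mulgA s_inv mulg1.
have signS A : sign_prod e (n :: A) = e n * sign_prod e A.
  by rewrite /sign_prod big_cons.
pose psin w := psi (w * s n)%g.
transitivity (\sum_(A <- subsets n) \sum_(B <- subsets n)
   2 * (psi ((subset_prod B)^-1 * subset_prod A)%g
         * (sign_prod e A * sign_prod e B)) +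
  \sum_(A <- subsets n) \sum_(B <- subsets n)
   (2 * e n) * (psin ((subset_prod B)^-1 * subset_prod A)%g
         * (sign_prod e A * sign_prod e B))).
  rewrite /= big_cat/= big_map -!big_split/=; apply: eq_bigr => A _.
  rewrite !big_cat/= !big_map -!big_split/=; apply: eq_bigr => B _.
  rewrite shift shiftV shift2 !signS /psin.
  have := e2 n; move: (psi _) (psi _) (sign_prod e A) (sign_prod e B) (e n).
  move=> y x a b z zz.
  transitivity (2 * (x * (a * b)) + 2 * z * (y * (a * b)) +
    (z * z - 1) * (x * a * b)).
    by ring.
  by rewrite zz; ring.
have pull (c : R) (F : seq nat -> seq nat -> R) :
    \sum_(A <- subsets n) \sum_(B <- subsets n) c * F A B =
    c * \sum_(A <- subsets n) \sum_(B <- subsets n) F A B.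
  by rewrite mulr_sumr; apply: eq_bigr => A _; rewrite mulr_sumr.
rewrite !pull !IH /= big_cat big_map/= exprS.
rewrite [X in _ = _ * (_ + X)](_ : _ =
    e n * \sum_(A <- subsets n) psin (subset_prod A) * sign_prod e A);
  last first.
  rewrite mulr_sumr; apply: eq_bigr => A _.
  rewrite signS /subset_prod big_cons -/(subset_prod A) -subset_prod_comm.
  by rewrite /psin; ring.
by ring.
Qed.

(** The test function is the character sign_prod e of the group of subsets, for
    which the quadratic form collapses to a single sum, up to a factor 2^n. *)
Lemma positive_definite_subset_sum (phi : W -> R[i]) e n :
  positive_definite phi -> (forall i, e i * e i = 1) ->
  \sum_(A <- subsets n) complex.Im (phi (subset_prod A)) * sign_prod e A = 0 /\
  0 <= \sum_(A <- subsets n) complex.Re (phi (subset_prod A)) * sign_prod e A.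
Proof.
move=> pd e2.
have := @positive_definite_family R W phi _ (subsets n) subset_prod
  (fun A => (sign_prod e A)%:C%C) pd.
move/complex_ge0P; rewrite Re_sum Im_sum.
have E A B : phi ((subset_prod B)^-1 * subset_prod A)%g * (sign_prod e A)%:C%C
    * ((sign_prod e B)%:C%C)^*%C =
    (sign_prod e A * sign_prod e B)%:C%C *
      phi ((subset_prod B)^-1 * subset_prod A)%g.
  by rewrite conjc_real rmorphM/=; ring.
under eq_bigr => A _.
  rewrite Im_sum; under eq_bigr do rewrite E Im_realM.
  over.
rewrite (@sum_subset_pairs e n (fun w => complex.Im (phi w)) e2).
under [X in _ /\ 0 <= X]eq_bigr => A _.
  rewrite Re_sum; under eq_bigr do rewrite E Re_realM.
  over.
rewrite (@sum_subset_pairs e n (fun w => complex.Re (phi w)) e2).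
have n2 : 0 < 2 ^+ n :> R by rewrite exprn_gt0.
rewrite pmulr_rge0// => -[/eqP]; rewrite mulf_eq0 gt_eqF//= => /eqP -> ?.
by split.
Qed.

End Commuting.
End SubsetSums.

(** * Positive definite radial functions are integrals *)

Section PowerMoments.
Variable R : realType.

(** The affine map u -> 2u - 1 carries the Hausdorff moment problem on [0, 1] to
    the moment problem on [-1, 1]; on polynomials it is inverse to substituting
    Y = (1 + X) / 2. *)
Lemma measure_of_moments (a : nat -> R) : a 0%N = 1 ->
  (forall k l, 0 <= moment_functional a ((1 - 'X) ^+ k * (1 + 'X) ^+ l)) ->
  exists mu : probability (measurableTypeR R) R,
    mu `[-1, 1]%classic = 1%E /\
    forall n, a n = \int[mu]_(q in `[-1, 1]%classic) (q ^+ n).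
Proof.
move=> a0 a_ge0; pose Y : {poly R} := 2^-1 *: (1 + 'X).
have Y1 : 1 - Y = 2^-1 *: (1 - 'X).
  rewrite /Y; apply: (@scalerI _ _ 2); rewrite ?pnatr_eq0//.
  by rewrite scalerBr !scalerA divff ?pnatr_eq0// !scale1r scaler_nat; ring.
pose M : {linear {poly R} -> R^o} := (moment_functional a \o comp_poly Y).
have M1 : M 1 = 1.
  by rewrite /M/= rmorph1 -(expr0 'X) moment_functionalXn.
have M_ge0 k l : 0 <= M ('X ^+ k * (1 - 'X) ^+ l).
  rewrite /M/= rmorphM/= !rmorphXn/= rmorphB/= rmorph1 comp_polyX Y1 !exprZn.
  rewrite -scalerAl -scalerAr scalerA linearZ/=.
  apply: mulr_ge0; first by rewrite mulr_ge0// exprn_ge0.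
  by rewrite mulrC; exact: a_ge0.
have [Q [Q_nd Q01 QM]] := hausdorff_moment M1 M_ge0.
pose X (u : measurableTypeR R) : measurableTypeR R := 2 * Q u - 1.
have mQ : measurable_fun [set: measurableTypeR R] Q.
  exact: nondecreasing_measurable.
have mX : measurable_fun [set: measurableTypeR R] X.
  by apply: measurable_funB => //; exact: measurable_funM.
have X1 u : -1 <= X u <= 1 by rewrite /X; have := Q01 u; lra.
pose XX := mfun_Sub (mem_set mX : X \in mfun).
pose rv : {RV (uniform01 R) >-> measurableTypeR R} := XX.
have preim : X @^-1` `[-1, 1]%classic = setT.
  by apply/seteqP; split => // u _; rewrite /= in_itv/=; exact: X1.
exists (distribution (uniform01 R) rv); split.
  by rewrite /distribution /pushforward/= preim; exact: probability_setT.
have MQ p : M p = \int[uniform01 R]_u p.[Q u].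
  rewrite (@Rintegral_horner _ _ _ _ _ _ _ _ mQ)//; last 2 first.
  - by apply: le_lt_trans (probability_le1 _ _) (ltry 1).
  - by move=> u _; have /andP[Q0 Q1] := Q01 u; rewrite ger0_norm.
  rewrite -{1}[p]coefK poly_def linear_sum; apply: eq_bigr => i _.
  by rewrite linearZ QM.
move=> n.
have -> : a n = M ((2 *: 'X - 1) ^+ n).
  rewrite /M/= rmorphXn/= rmorphB/= rmorph1 linearZ/= comp_polyX /Y scalerA.
  by rewrite divff ?pnatr_eq0// scale1r addrAC subrr add0r moment_functionalXn.
rewrite MQ /Rintegral/= integral_pushforward//=; last 2 first.
  by apply: measurableT_comp => //; exact: exprn_measurable.
  rewrite preim; apply: integrable_pow => //.
  - by apply: le_lt_trans (probability_le1 _ _) (ltry 1).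
  - by move=> u _; rewrite ler_norml X1.
rewrite preim; congr fine; apply: eq_integral => u _ /=.
by rewrite horner_exp hornerD hornerN hornerZ hornerX hornerC.
Qed.

End PowerMoments.

Section Necessity.
Variables (R : realType) (W : groupType) (S S0 : set W).
Hypotheses (cS : coxeter_system S) (S0S : S0 `<=` S) (S0inf : infinite_set S0).
Hypothesis S0C : forall s t, S0 s -> S0 t -> (s * t = t * s)%g.

Lemma commuting_sequence : exists s : nat -> W,
  [/\ injective s, forall i, S (s i) & forall i j, (s i * s j = s j * s i)%g].
Proof.
have /infiniteP/card_leP[f] := S0inf.
pose s n : W := val (f (exist _ n (in_setT n))).
have s0 n : S0 (s n) by apply: set_mem; exact: valP.
exists s; split; [|by move=> i; exact: S0S|by move=> i j; exact: S0C].
move=> i j /val_inj /(@inj _ _ _ f) /= H.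
by have := H (in_setT _) (in_setT _) => -[].
Qed.

Lemma word_length_subset_prod (s : nat -> W) (A : seq nat) :
  injective s -> (forall i, S (s i)) ->
  (forall i j, (s i * s j = s j * s i)%g) -> uniq A ->
  word_length S (subset_prod s A) = size A.
Proof.
move=> s_inj sS sC uA; have [N HN] := coxeter_inversion_cocycle cS.
rewrite /subset_prod -(big_map s xpredT id) (word_length_prod_commuting cS HN).
- by rewrite size_map.
- by move=> _ /mapP[i _ ->].
- by move=> _ _ /mapP[i _ ->] /mapP[j _ ->].
- by rewrite map_inj_uniq.
Qed.

Lemma exists_word_length n : exists w, word_length S w = n.
Proof.
have [s [s_inj sS sC]] := commuting_sequence.
exists (subset_prod s (iota 0 n)).
by rewrite word_length_subset_prod// ?size_iota ?iota_uniq.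
Qed.

Variable phi : W -> R[i].
Hypotheses (rad : radial S phi) (phi1 : phi 1%g = 1).

(** The values of phi are those of the moment functional on products of 1 - X
    and 1 + X.  These are nonnegative reals, so phi is real, because
    2X = (1 + X) - (1 - X) writes 2^n X^n as a combination of such products. *)
Lemma positive_definite_represents : positive_definite phi ->
  exists mu : probability (measurableTypeR R) R, represents S phi mu.
Proof.
move=> pd; have [s [s_inj sS sC]] := commuting_sequence.
have s_inv i : (s i * s i = 1)%g by exact: (coxeter_involution cS (sS i)).
pose z n := phi (subset_prod s (iota 0 n)).
have phiz w : phi w = z (word_length S w).
  by apply: rad; rewrite word_length_subset_prod ?iota_uniq// size_iota.
pose e k i : R := if (i < k)%N then -1 else 1.
have e2 k i : e k i * e k i = 1.
  by rewrite /e; case: ltnP => _; rewrite ?mulrNN mulr1.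
have eE k l : \prod_(i < k + l) (1 + e k i *: 'X) =
    (1 - 'X) ^+ k * (1 + 'X) ^+ l :> {poly R}.
  rewrite big_split_ord/=; congr (_ * _).
    rewrite -[in RHS](card_ord k) -prodr_const; apply: eq_bigr => i _.
    by rewrite /e ltn_ord scaleN1r.
  rewrite -[in RHS](card_ord l) -prodr_const; apply: eq_bigr => i _.
  by rewrite /e ltnNge leq_addr scale1r.
have LE (f : R[i] -> R) k l :
    moment_functional (f \o z) ((1 - 'X) ^+ k * (1 + 'X) ^+ l) =
    \sum_(A <- subsets (k + l)) f (phi (subset_prod s A)) * sign_prod (e k) A.
  rewrite -eE -sum_subsets_poly linear_sum big_seq [RHS]big_seq.
  apply: eq_bigr => A /subsets_uniq[uA _].
  rewrite linearZ/= moment_functionalXn /GRing.scale/= mulrC; congr (f _ * _).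
  by rewrite phiz word_length_subset_prod.
have pos k l := positive_definite_subset_sum sC s_inv (k + l) pd (e2 k).
have Im0 n : complex.Im (z n) = 0.
  have L0 k l : moment_functional (@complex.Im R \o z)
      ((1 - 'X) ^+ k * (1 + 'X) ^+ l) = 0.
    by rewrite LE; have [] := pos k l.
  have XE : 2 ^+ n *: 'X^n = \sum_(i < n.+1)
      ((-1) ^+ i *: ((1 - 'X) ^+ i * (1 + 'X) ^+ (n - i))) *+ 'C(n, i)
      :> {poly R}.
    have -> : 2 ^+ n *: 'X^n = ((1 + 'X) + (-1) *: (1 - 'X)) ^+ n :> {poly R}.
      by rewrite -exprZn; congr (_ ^+ n); rewrite scaleN1r scaler_nat; ring.
    rewrite exprDn; apply: eq_bigr => i _.
    by rewrite exprZn -scalerAr mulrC.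
  have : moment_functional (@complex.Im R \o z) (2 ^+ n *: 'X^n) = 0.
    rewrite XE linear_sum big1// => i _.
    by rewrite linearMn linearZ/= L0 scaler0 mul0rn.
  rewrite linearZ/= moment_functionalXn => /eqP.
  by rewrite mulf_eq0 expf_eq0 pnatr_eq0 andbF/= => /eqP.
have [||mu [mu1 muE]] := @measure_of_moments R (@complex.Re R \o z).
- by rewrite /= /z /subset_prod big_nil phi1.
- by move=> k l; rewrite LE; have [] := pos k l.
exists mu; split=> // w; rewrite phiz -muE /=.
by move: (Im0 (word_length S w)); case: (z _) => x y /= ->.
Qed.

End Necessity.

(** * A law on [-1, 1] is determined by its moments *)

Section Indicator.
Variable R : realType.

Lemma bernoulli_inequality (t : R) m : -1 <= t -> 1 + m%:R * t <= (1 + t) ^+ m.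
Proof.
move=> t1; elim: m => [|m IH]; first by rewrite mul0r addr0 expr0.
rewrite exprSr; apply: (@le_trans _ _ ((1 + m%:R * t) * (1 + t))).
  rewrite -natr1 -subr_ge0 (_ : _ - _ = m%:R * t ^+ 2); last by ring.
  by rewrite mulr_ge0// sqr_ge0.
by rewrite ler_wpM2r//; lra.
Qed.

(** By Bernoulli's inequality the sequence lies between 1 - (2x)^n and 1. *)
Lemma cvg_threshold_lt (x : R) : 0 <= x < 2^-1 ->
  (1 - x ^+ n) ^+ (2 ^ n) @[n --> \oo] --> (1 : R).
Proof.
move=> /andP[x0 x2].
apply: (@squeeze_cvgr _ _ _ _ (fun n => 1 - (2 * x) ^+ n) (cst 1)).
- apply: nearW => n; have xn0 : 0 <= x ^+ n by exact: exprn_ge0.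
  have xn1 : x ^+ n <= 1 by rewrite exprn_ile1//; lra.
  apply/andP; split; last by rewrite exprn_ile1; lra.
  have := @bernoulli_inequality (- x ^+ n) (2 ^ n).
  by rewrite exprMn -natrX mulrN; apply; lra.
- rewrite -[X in _ --> X]subr0; apply: cvgB; first exact: cvg_cst.
  by apply: cvg_expr; rewrite ger0_norm ?mulr_ge0//; lra.
- exact: cvg_cst.
Qed.

(** By Bernoulli's inequality 1 + (2x)^n <= (1 + x^n)^(2^n), and
    (1 - x^n) (1 + x^n) <= 1, so the sequence is at most (2x)^-n. *)
Lemma cvg_threshold_gt (x : R) : 2^-1 < x <= 1 ->
  (1 - x ^+ n) ^+ (2 ^ n) @[n --> \oo] --> (0 : R).
Proof.
move=> /andP[x2 x1].
apply: (@squeeze_cvgr _ _ _ _ (cst 0) (fun n => (2 * x)^-1 ^+ n)).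
- apply: nearW => n; have xn0 : 0 <= x ^+ n by rewrite exprn_ge0//; lra.
  have xn1 : x ^+ n <= 1 by rewrite exprn_ile1//; lra.
  have A0 : 0 <= (1 - x ^+ n) ^+ (2 ^ n) by rewrite exprn_ge0//; lra.
  rewrite A0/= exprVn -[leRHS]mul1r ler_pdivlMr ?exprn_gt0 ?mulr_gt0//;
    last by lra.
  have B : (2 * x) ^+ n <= (1 + x ^+ n) ^+ (2 ^ n).
    rewrite exprMn -natrX; apply: le_trans (bernoulli_inequality _ _); lra.
  apply: (@le_trans _ _ ((1 - x ^+ n) ^+ (2 ^ n) * (1 + x ^+ n) ^+ (2 ^ n))).
    by rewrite ler_wpM2l//; lra.
  rewrite -exprMn exprn_ile1//; first by rewrite mulr_ge0//; lra.
  by rewrite -subr_ge0 (_ : _ - _ = (x ^+ n) ^+ 2) ?sqr_ge0//; ring.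
- exact: cvg_cst.
- have x0 : 0 < 2 * x by lra.
  by apply: cvg_expr; rewrite ger0_norm ?invr_ge0 ?(ltW x0)// invf_lt1//; lra.
Qed.

(** The variable y has the sign of q - c and lies in [-1, 1] when q does.  The
    first factor separates y < 0 from y > 0, its argument 1/2 + y/4 being in
    [1/4, 3/4]; the second factor makes the product vanish at y = 0 and tends to
    1 elsewhere, so that the limit is the indicator of q < c at every point. *)
Definition threshold_poly (c : R) (n : nat) : {poly R} :=
  let y := (1 + `|c|)^-1 *: ('X - c%:P) in
  (1 - (2^-1%:P + 4^-1 *: y) ^+ n) ^+ (2 ^ n) * (1 - (1 - y ^+ 2) ^+ n).

Lemma threshold_polyE c n q : (threshold_poly c n).[q] =
  let y := (1 + `|c|)^-1 * (q - c) in
  (1 - (2^-1 + 4^-1 * y) ^+ n) ^+ (2 ^ n) * (1 - (1 - y ^+ 2) ^+ n).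
Proof. by rewrite /threshold_poly; do ! rewrite ?hornerE ?horner_exp. Qed.

Lemma threshold_variable (c q : R) : -1 <= q <= 1 ->
  let y := (1 + `|c|)^-1 * (q - c) in
  [/\ -1 <= y <= 1, (q < c) = (y < 0) & (c < q) = (0 < y)].
Proof.
move=> /andP[q1 q2] y; have c0 : 0 < 1 + `|c| by rewrite ltr_pwDl.
have yE : (1 + `|c|) * y = q - c by rewrite /y mulVKf// gt_eqF.
have [c1 c2] : - `|c| <= c /\ c <= `|c|.
  by rewrite ler_norm lerNl -normrN ler_norm.
split.
- rewrite -ler_norml normrM gtr0_norm ?invr_gt0// mulrC ler_pdivrMr// mul1r.
  by apply: (le_trans (ler_normB _ _)); rewrite lerD2r ler_norml q1.
- by rewrite -subr_lt0 -yE pmulr_rlt0.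
- by rewrite -subr_gt0 -yE pmulr_rgt0.
Qed.

Lemma threshold_poly_bound c n q : -1 <= q <= 1 ->
  `|(threshold_poly c n).[q]| <= 1.
Proof.
move=> /(threshold_variable c); rewrite threshold_polyE /=.
move: (_ * (q - c)) => y [/andP[y1 y2] _ _].
have x0 : 0 <= (2^-1 + 4^-1 * y) ^+ n by rewrite exprn_ge0//; lra.
have x1 : (2^-1 + 4^-1 * y) ^+ n <= 1 by rewrite exprn_ile1//; lra.
have yy : 0 <= 1 - y ^+ 2 <= 1.
  by apply/andP; split; nra.
have /andP[w0 w1] : 0 <= (1 - y ^+ 2) ^+ n <= 1.
  by case/andP: yy => a b; rewrite exprn_ge0// exprn_ile1.
rewrite normrM mulr_ile1// ger0_norm ?exprn_ge0 ?exprn_ile1//; lra.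
Qed.

Lemma cvg_threshold_poly c q : -1 <= q <= 1 ->
  (threshold_poly c n).[q] @[n --> \oo] --> (\1_(`]-oo, c[%classic) q : R).
Proof.
move=> /(threshold_variable c)/=.
rewrite (_ : (fun n => (threshold_poly c n).[q]) =
    fun n => let y := (1 + `|c|)^-1 * (q - c) in
      (1 - (2^-1 + 4^-1 * y) ^+ n) ^+ (2 ^ n) * (1 - (1 - y ^+ 2) ^+ n));
  last first.
  by apply/funext => n; exact: threshold_polyE.
rewrite /=; set y := _ * (q - c) => -[/andP[y1 y2] qc cq].
have y2_cvg : y != 0 -> 1 - (1 - y ^+ 2) ^+ n @[n --> \oo] --> (1 : R).
  move=> y0; have yy : 0 < y ^+ 2 by rewrite exprn_even_gt0.
  rewrite -(subr0 (1 : R)); apply: cvgB; first by rewrite subr0; exact: cvg_cst.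
  by rewrite subr0; apply: cvg_expr; rewrite ger0_norm; nra.
rewrite indicE; have -> : (q \in `]-oo, c[%classic) = (y < 0).
  by rewrite -qc; apply/idP/idP; rewrite inE/= in_itv.
have [y_lt|y_gt|y0] := ltgtP y 0.
- have x_lt : 0 <= 2^-1 + 4^-1 * y < 2^-1 by lra.
  have y_neq0 : y != 0 by lra.
  rewrite (_ : true%:R = 1 * 1 :> R); last by rewrite mulr1.
  by apply: cvgM; [exact: cvg_threshold_lt|exact: y2_cvg].
- have x_gt : 2^-1 < 2^-1 + 4^-1 * y <= 1 by lra.
  have y_neq0 : y != 0 by lra.
  rewrite (_ : false%:R = 0 * 1 :> R); last by rewrite mulr1.
  by apply: cvgM; [exact: cvg_threshold_gt|exact: y2_cvg].
- have -> : (fun n => (1 - (2^-1 + 4^-1 * y) ^+ n) ^+ (2 ^ n) *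
      (1 - (1 - y ^+ 2) ^+ n)) = cst 0; last exact: cvg_cst.
  by apply/funext => n; rewrite y0 expr0n/= subr0 expr1n subrr mulr0.
Qed.

Lemma probability_setI_full d (T : measurableType d) (P : probability T R)
    (A D : set T) : measurable A -> measurable D -> P D = 1%E ->
  P (A `&` D) = P A.
Proof.
move=> mA mD PD.
have -> : P A = (P (A `\` D) + P (A `&` D))%E by exact: measureDI.
suff -> : P (A `\` D) = 0%E by rewrite add0e.
apply/eqP; rewrite eq_le measure_ge0 andbT.
apply: (@le_trans _ _ (P (~` D))).
  by apply: le_measure; rewrite ?inE//; [exact: measurableD|exact: measurableC].
have -> : P (~` D) = (1 - P D)%E by exact: probability_setC.
by rewrite PD subee.
Qed.

(** Integrals of the threshold polynomials depend on the moments only, and by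
    dominated convergence they tend to the measure of ]-oo, c[; these rays are
    stable under intersection and generate the Borel sets. *)
Lemma determined_by_moments (mu nu : probability (measurableTypeR R) R) :
  mu `[-1, 1]%classic = 1%E -> nu `[-1, 1]%classic = 1%E ->
  (forall n, \int[mu]_(q in `[-1, 1]%classic) (q ^+ n) =
             \int[nu]_(q in `[-1, 1]%classic) (q ^+ n)) ->
  forall A : set R, measurable (A : set (measurableTypeR R)) -> mu A = nu A.
Proof.
move=> mu1 nu1 mom.
pose D : set (measurableTypeR R) := `[-1, 1]%classic.
have mD : measurable D by exact: measurable_itv.
have finD (m : probability (measurableTypeR R) R) : (m D < +oo)%E.
  by apply: le_lt_trans (probability_le1 _ mD) (ltry 1).
have D1 q : D q -> `|q| <= 1 by rewrite /D/= in_itv/= ler_norml.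
have mid : measurable_fun D (idfun : measurableTypeR R -> R).
  exact: measurable_id.
have polyE (m : probability (measurableTypeR R) R) (p : {poly R}) :
    \int[m]_(q in D) p.[q] =
    \sum_(i < size p) p`_i * \int[m]_(q in D) (q ^+ i).
  exact: (Rintegral_horner mD (finD m) mid D1).
have cvg_m (m : probability (measurableTypeR R) R) c : m D = 1%E ->
    (\int[m]_(q in D) ((threshold_poly c n).[q])%:E)%E @[n --> \oo]
      --> m `]-oo, c[%classic.
  move=> m1.
  have <- : (\int[m]_(q in D) (\1_(`]-oo, c[%classic) q)%:E)%E =
      m `]-oo, c[%classic.
    by rewrite integral_indic//; exact: probability_setI_full.
  apply: (@dominated_cvg _ _ _ _ _ mD _ _ (cst 1%E)).
  - move=> n; apply/measurable_EFinP; apply: measurable_funTS.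
    apply: continuous_measurable_fun; exact: continuous_horner.
  - move=> q; rewrite /D/= in_itv/= => q1; apply: cvg_EFin; first exact: nearW.
    exact: cvg_threshold_poly.
  - by [].
  - exact: finite_measure_integrable_cst.
  - move=> n q; rewrite /D/= in_itv/= => q1; rewrite lee_fin.
    exact: threshold_poly_bound.
have int_fin (m : probability (measurableTypeR R) R) (p : {poly R}) :
    (\int[m]_(q in D) (p.[q])%:E)%E = (\int[m]_(q in D) p.[q])%:E.
  rewrite /Rintegral fineK//; apply: integrable_fin_num => //.
  exact: (integrable_horner mD (finD m) mid D1).
have eq_ray c : mu `]-oo, c[%classic = nu `]-oo, c[%classic.
  apply: cvg_unique (cvg_m mu c mu1) _ => //.
  rewrite (_ : (fun n => _) =
      fun n => (\int[nu]_(q in D) ((threshold_poly c n).[q])%:E)%E).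
    exact: cvg_m.
  apply/funext => n; rewrite !int_fin !polyE; congr (_%:E).
  by apply: eq_bigr => i _; rewrite mom.
move=> A mA; apply: (@measure_unique _ R (measurableTypeR R) (@RGenInftyO.G R)
  (fun k => `]-oo, k%:R[%classic) _ _ _ _ mu nu _ _ A mA).
- exact: RGenInftyO.measurableE.
- move=> _ _ [x ->] [y ->]; exists (Num.min x y).
  by apply/seteqP; split => z /=; rewrite !in_itv/= lt_min => /andP.
- by move=> k; exists k%:R.
- apply/seteqP; split => // x _; exists (Num.bound `|x|) => //=.
  by rewrite in_itv/= (le_lt_trans (ler_norm x))// archi_boundP.
- by move=> _ [x ->]; exact: eq_ray.
- move=> k; apply: le_lt_trans (probability_le1 _ _) (ltry 1).
  exact: measurable_itv.
Qed.

End Indicator.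

(** * The characterization *)

Theorem theorem4p1 (R : realType) (W : groupType) (S : set W)
    (S0 : set W) (phi : W -> R[i]) :
  coxeter_system S ->
  S0 `<=` S -> infinite_set S0 ->
  (forall s t, S0 s -> S0 t -> (s * t = t * s)%g) ->
  radial S phi ->
  phi 1%g = 1 ->
  (positive_definite phi <->
     exists mu : probability (measurableTypeR R) R, represents S phi mu) /\
  (forall mu nu : probability (measurableTypeR R) R,
     represents S phi mu -> represents S phi nu ->
     forall A : set R, measurable (A : set (measurableTypeR R)) -> mu A = nu A).
Proof.
move=> cS S0S S0inf S0C rad phi1; split.
  split; first exact: (positive_definite_represents cS S0S S0inf S0C rad phi1).
  by move=> [mu]; exact: represents_positive_definite.
move=> mu nu [mu1 muE] [nu1 nuE]; apply: determined_by_moments => // n.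
have [w <-] := exists_word_length cS S0S S0inf S0C n.
by have := muE w; rewrite nuE => /(congr1 (@complex.Re R)) /=.
Qed.
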